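(* Let $p\in[1,+\infty)$ and let $\mathfrak{m}$ be the Lebesgue measure on $\mathbb{R}^2$. Let $\{T_t\}_{t\ge0}$ be the strongly continuous semigroup on $L^p(\mathbb{R}^2;\mathfrak{m})$ generated by $$A=\frac12\frac{\partial^2}{\partial x_1^2}+\frac{\partial}{\partial x_2},\qquad x=(x_1,x_2),$$ i.e. the extension to $L^p(\mathbb{R}^2;\mathfrak{m})$ of the transition semigroup of the space-time Brownian motion (one-dimensional Brownian motion in the first coordinate, uniform motion to the right with unit speed in the second). Then $\{T_t\}_{t\ge0}$ is not an analytic semigroup on $L^p(\mathbb{R}^2;\mathfrak{m})$.
   Context: The transition semigroup is $P_tf(x,\tau)=\mathbf{E}[f(x+B_t,\tau+t)]$ for $(x,\tau)\in\mathbb{R}^2$, with $\{B_t\}$ a one-dimensional standard Brownian motion started at $0$. $L^p$-functions are complex valued. For $\delta\in(0,\pi)$ put $S_\delta=\{\lambda\in\mathbb{C}\setminus\{0\}:|\arg\lambda|<\delta\}$. A strongly continuous semigroup $\{T_t\}_{t\ge0}$ on $L^p$ is analytic if there exists $\delta\in(0,\pi/2]$ such that it extends to a family of operators $\{T_z\}_{z\in S_\delta\cup\{0\}}$ on $L^p$ with: $T_{z_1+z_2}=T_{z_1}T_{z_2}$ for $z_1,z_2\in S_\delta$; $z\mapsto T_z$ analytic on $S_\delta$; and $\lim_{z\in S_\varepsilon,\,z\to0}T_zf=f$ for any $f\in L^p$ and $\varepsilon\in(0,\delta)$. *)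

(* Defs.v *)
From HB Require Import structures.
From mathcomp Require Import all_boot all_order all_algebra.
From mathcomp Require Import complex.
From mathcomp Require Import all_classical all_reals all_analysis.

Set Implicit Arguments.
Unset Strict Implicit.
Unset Printing Implicit Defensive.

Import Order.TTheory GRing.Theory Num.Theory.
Import numFieldNormedType.Exports.
Import Normc.

Local Open Scope classical_set_scope.
Local Open Scope ring_scope.
Local Open Scope complex_scope.

Section complex_sectors.
Context {R : realType}.

(* Principal argument, valued in ]-pi, pi]; only meaningful for z != 0. *)
Definition Arg (z : R[i]) : R :=
  let theta := acos (complex.Re z / normc z) in
  if 0 <= complex.Im z then theta else - theta.

Definition sector (delta : R) : set R[i] :=
  [set z | z != 0 /\ `|Arg z| < delta].

End complex_sectors.

(* The complex space L^p(R^2; m) is handled through representatives: its       *)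
(* elements are the functions f with inLp p f, and equality in L^p is equality *)
(* almost everywhere.  An operator on L^p is a map on functions of which only  *)
(* the values on inLp p matter, up to almost-everywhere equality.              *)
Section complex_Lp.
Context {R : realType}.

Definition plane_measure :
    {measure set (measurableTypeR R * measurableTypeR R) -> \bar R} :=
  (lebesgue_measure \x lebesgue_measure)%E.

Definition cmeasurable (f : R * R -> R[i]) : Prop :=
  measurable_fun setT (fun x => complex.Re (f x)) /\
  measurable_fun setT (fun x => complex.Im (f x)).

Definition Lpnorm (p : R) (f : R * R -> R[i]) : \bar R :=
  Lnorm plane_measure p%:E (fun x => (normc (f x))%:E).

Definition inLp (p : R) (f : R * R -> R[i]) : Prop :=
  cmeasurable f /\ (Lpnorm p f < +oo)%E.

Definition operator : Type := (R * R -> R[i]) -> (R * R -> R[i]).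

(* Linearity and boundedness together make S compatible with a.e. equality,   *)
(* so that it descends to classes.                                            *)
Definition bounded_operator (p : R) (S : operator) : Prop :=
  [/\ forall f, inLp p f -> inLp p (S f),
      forall (a : R[i]) f g, inLp p f -> inLp p g ->
        S (fun x => a * f x + g x) = (fun x => a * S f x + S g x)
          %[ae plane_measure]
    & exists M : R, forall f, inLp p f ->
        (Lpnorm p (S f) <= M%:E * Lpnorm p f)%E].

Definition opnorm (p : R) (S : operator) : \bar R :=
  ereal_sup [set Lpnorm p (S f) | f in
    [set f | inLp p f /\ (Lpnorm p f <= 1%:E)%E]].

Definition strongly_continuous_semigroup (p : R) (T : R -> operator) : Prop :=
  [/\ forall t, 0 <= t -> bounded_operator p (T t),
      forall f, inLp p f -> T 0 f = f %[ae plane_measure],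
      forall s t f, 0 <= s -> 0 <= t -> inLp p f ->
        T (s + t) f = T s (T t f) %[ae plane_measure]
    & forall f, inLp p f ->
        Lpnorm p (fun x => T t f x - f x) @[t --> 0^'+] --> 0%E].

(* The generator of T is defined at f, with value g. *)
Definition generator_at (p : R) (T : R -> operator) (f g : R * R -> R[i])
    : Prop :=
  [/\ inLp p f, inLp p g
    & Lpnorm p (fun x => (t^-1)%:C * (T t f x - f x) - g x) @[t --> 0^'+]
        --> 0%E].

(* Analyticity of z |-> S z is complex differentiability, in the operator     *)
(* norm, at every point of the (open) sector.                                 *)
Definition analytic_on (p : R) (D : set R[i]) (S : R[i] -> operator) : Prop :=
  forall z0, D z0 -> exists S' : operator, bounded_operator p S' /\
    opnorm p (fun f x => (z - z0)^-1 * (S z f x - S z0 f x) - S' f x)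
      @[z --> (z0 : (R[i] : numFieldType))^'] --> 0%E.

Definition analytic_semigroup (p : R) (T : R -> operator) : Prop :=
  exists delta : R, 0 < delta <= pi / 2 /\
  exists S : R[i] -> operator,
  [/\ forall z, sector delta z \/ z = 0 -> bounded_operator p (S z),
      forall t f, 0 <= t -> inLp p f ->
        S t%:C f = T t f %[ae plane_measure],
      forall z1 z2 f, sector delta z1 -> sector delta z2 -> inLp p f ->
        S (z1 + z2) f = S z1 (S z2 f) %[ae plane_measure],
      analytic_on p (sector delta) S
    & forall f (eps : R), inLp p f -> 0 < eps < delta ->
        Lpnorm p (fun x => S z f x - f x)
          @[z --> within (sector eps) (nbhs (0 : (R[i] : numFieldType)))]
          --> 0%E].

End complex_Lp.

Section brownian_motion.
Context {R : realType} {d : measure_display} {Omega : measurableType d}.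
Variable P : probability Omega R.

(* Only the variables B t with 0 <= t are constrained. *)
Definition standard_brownian_motion (B : R -> {RV P >-> R}) : Prop :=
  [/\ {ae P, forall w, B 0 w = 0},
      forall (n : nat) (t : nat -> R) (A : nat -> set R),
        0 <= t 0%N -> nondecreasing_seq t -> (forall i, measurable (A i)) ->
        P (\bigcap_(i in [set i | (i < n)%N])
             [set w | A i (B (t i.+1) w - B (t i) w)]) =
        (\prod_(i < n) P [set w | A i (B (t i.+1) w - B (t i) w)%R])%E,
      forall (s t : R) (A : set R), 0 <= s < t -> measurable A ->
        P [set w | A (B t w - B s w)] = normal_prob 0 (Num.sqrt (t - s)) A
    & {ae P, forall w, {within `[0, +oo[, continuous (fun t => B t w)}}].

Definition cexpectation (X : Omega -> R[i]) : R[i] :=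
  fine 'E_P[fun w => complex.Re (X w)] +i* fine 'E_P[fun w => complex.Im (X w)].

Definition transition (B : R -> {RV P >-> R}) (t : R) : @operator R :=
  fun f x => cexpectation (fun w => f (x.1 + B t w, x.2 + t)).

(* The transition semigroup acts on bounded Borel functions; T extends it to  *)
(* L^p when both agree on the bounded Borel functions that lie in L^p.        *)
Definition extends_transition (p : R) (B : R -> {RV P >-> R})
    (T : R -> operator) : Prop :=
  forall t f, 0 <= t -> inLp p f -> (exists M : R, forall x, normc (f x) <= M) ->
    T t f = transition B t f %[ae plane_measure].

End brownian_motion.

Section spacetime_generator.
Context {R : realType}.

(* partial false = d/dx1, partial true = d/dx2 *)
Definition direction (b : bool) : R * R := if b then (0, 1) else (1, 0).

Definition partial (b : bool) (u : R * R -> R) : R * R -> R :=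
  fun x => 'D_(direction b) u x.

Definition smooth (u : R * R -> R) : Prop :=
  forall bs : seq bool, let v := foldr partial u bs in
    continuous v /\ forall x b, derivable v x (direction b).

Definition test_function (f : R * R -> R[i]) : Prop :=
  [/\ smooth (fun x => complex.Re (f x)), smooth (fun x => complex.Im (f x))
    & compact (closure [set x | f x != 0])].

Definition spacetime_operator_real (u : R * R -> R) : R * R -> R :=
  fun x => 2^-1 * partial false (partial false u) x + partial true u x.

Definition spacetime_operator (f : R * R -> R[i]) : R * R -> R[i] :=
  fun x => spacetime_operator_real (fun y => complex.Re (f y)) x
        +i* spacetime_operator_real (fun y => complex.Im (f y)) x.

(* "T is generated by A": the generator of T coincides with A on the complex  *)
(* valued test functions, which form a core, so this determines T.            *)
Definition generated_by_spacetime_operator (p : R) (T : R -> operator) : Prop :=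
  forall f, test_function f -> generator_at p T f (spacetime_operator f).

End spacetime_generator.

(* Main.v *)
Require Import Defs.
From HB Require Import structures.
From mathcomp Require Import all_boot all_order all_algebra.
From mathcomp Require Import complex.
From mathcomp Require Import all_classical all_reals all_analysis.
From mathcomp Require Import measurable_realfun lra.

(** An analytic semigroup is differentiable in operator norm at every positive
    time, so near time 1 it is Lipschitz in operator norm
    ([analytic_lipschitz]): for small [h > 0] and [f] in the unit ball,
    [T (1 + h) f] and [T 1 f] differ by at most [C * h] in the L^p norm.

    The second coordinate of the space-time Brownian motion is a deterministic
    translation, which forbids this.  Take [f] to be the indicator of a
    rectangle [Q] of area 1 with second side [0 <= x.2 < h].  Then [T 1 f] and
    [T (1 + h) f] vanish off the strips [-1 <= x.2 < -1 + h] and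
    [-1 - h <= x.2 < -1], which are disjoint, so their distance is at least the
    norm of [T 1 f].  This norm is bounded below independently of [h]: choose
    [K] with [c = P(|B 1| <= K) > 0] ([tight]); at a point of the first strip
    whose first coordinate is at distance at least [K] from the ends of the
    first side of [Q], the value of [T 1 f] is at least [c]
    ([transition_cindic]).  The first side of [Q] has length [1/h], so for
    small [h] these points fill a rectangle [E] of area at least [1/2].  Hence
    [c * 2^(-1/p) <= C * h] for all small [h], which is absurd. *)

Import Order.TTheory GRing.Theory Num.Theory.
Import numFieldNormedType.Exports.
Local Open Scope classical_set_scope.
Local Open Scope ring_scope.

(** * The norm of complex L^p functions on the plane *)

(** Resolution does not see through [plane_measure] to the product measure, so
    the filter of its full sets is registered explicitly. *)
#[local] Instance plane_ae_filter (R : realType) :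
  Filter (nbhs (almost_everywhere (@plane_measure R))).
Proof. exact: ae_filter_ringOfSetsType. Qed.

Section Lp_norm.
Set Implicit Arguments.
Unset Strict Implicit.
Context {R : realType}.
Implicit Types (p : R) (f g : R * R -> R[i]) (E : set (R * R)).

Lemma cmeasurableD f g :
  cmeasurable f -> cmeasurable g -> cmeasurable (fun x => f x + g x).
Proof.
move=> [f1 f2] [g1 g2]; split.
- by under eq_fun do rewrite raddfD /=; exact: measurable_funD.
- by under eq_fun do rewrite raddfD /=; exact: measurable_funD.
Qed.

Lemma cmeasurableZ (k : R[i]) f :
  cmeasurable f -> cmeasurable (fun x => k * f x).
Proof.
case: k => a b [f1 f2]; split.
- rewrite (_ : (fun _ => _) =
    (fun x => a * complex.Re (f x) - b * complex.Im (f x))).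
    by apply: measurable_funB; apply: measurable_funM.
  by apply/funext => x; case: (f x).
- rewrite (_ : (fun _ => _) =
    (fun x => a * complex.Im (f x) + b * complex.Re (f x))).
    by apply: measurable_funD; apply: measurable_funM.
  by apply/funext => x; case: (f x) => u v /=; rewrite addrC // mulrC.
Qed.

Lemma cmeasurableB f g :
  cmeasurable f -> cmeasurable g -> cmeasurable (fun x => f x - g x).
Proof.
move=> mf mg; have := cmeasurableD mf (cmeasurableZ (-1) mg).
by congr cmeasurable; apply/funext => x; rewrite mulN1r.
Qed.

Lemma normc_ge0 (z : R[i]) : 0 <= Normc.normc z.
Proof. by case: z => a b /=; exact: sqrtr_ge0. Qed.

Lemma measurable_normc f : cmeasurable f ->
  measurable_fun setT (fun x => Normc.normc (f x)).
Proof.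
move=> [f1 f2].
rewrite (_ : (fun _ => _) = Num.sqrt \o
  (fun x => complex.Re (f x) ^+ 2 + complex.Im (f x) ^+ 2)).
  apply: measurableT_comp.
    apply: continuous_measurable_fun; exact: sqrt_continuous.
  by apply: measurable_funD; exact: measurable_funX.
by apply/funext => x /=; case: (f x).
Qed.

Lemma measurable_normc_poweR p f : cmeasurable f ->
  measurable_fun setT (fun x => (`|(Normc.normc (f x))%:E| `^ p)%E).
Proof.
move=> mf; apply: (measurableT_comp (measurable_poweR _)).
apply: measurableT_comp => //; apply/measurable_EFinP.
exact: measurable_normc.
Qed.

Lemma ae_le_Lpnorm p f g : 0 < p -> cmeasurable f -> cmeasurable g ->
  {ae plane_measure, forall x, Normc.normc (f x) <= Normc.normc (g x)} ->
  (Lpnorm p f <= Lpnorm p g)%E.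
Proof.
move=> p0 mf mg fg; rewrite /Lpnorm unlock.
apply: gt0_ler_poweR; rewrite ?invr_ge0 ?(ltW p0)//.
- by rewrite in_itv/= leey integral_ge0// => x _; exact: poweR_ge0.
- by rewrite in_itv/= leey integral_ge0// => x _; exact: poweR_ge0.
apply: ae_ge0_le_integral => //; [|exact: measurable_normc_poweR| |exact: measurable_normc_poweR|].
- by move=> x _; exact: poweR_ge0.
- by move=> x _; exact: poweR_ge0.
apply: filterS fg => x fgx _; rewrite gt0_ler_poweR ?(ltW p0)//.
- by rewrite in_itv/= leey lee_fin normr_ge0.
- by rewrite in_itv/= leey lee_fin normr_ge0.
- by rewrite !gee0_abs ?lee_fin ?normc_ge0.
Qed.

Lemma LpnormZ p (k : R[i]) f : 0 < p -> cmeasurable f ->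
  Lpnorm p (fun x => k * f x) = ((Normc.normc k)%:E * Lpnorm p f)%E.
Proof.
move=> p0 mf; rewrite /Lpnorm unlock.
under eq_integral => x _.
  rewrite Normc.normcM EFinM abseM poweRM//.
  rewrite gee0_abs ?lee_fin ?normc_ge0// poweR_EFin. over.
rewrite /= ge0_integralZl_EFin//=; last 2 first.
- exact: (measurable_normc_poweR p mf).
- exact: powR_ge0.
rewrite poweRM ?lee_fin ?powR_ge0 ?integral_ge0//.
by rewrite poweR_EFin -powRrM mulfV ?gt_eqF// powRr1// normc_ge0.
Qed.

(** Minkowski's inequality holds for the real functions [|f|] and [|g|], and
    [|f + g| <= |f| + |g|]. *)
Lemma LpnormD p f g : 1 <= p -> cmeasurable f -> cmeasurable g ->
  (Lpnorm p (fun x => (f x + g x)%R) <= Lpnorm p f + Lpnorm p g)%E.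
Proof.
move=> p1 mf mg; have p0 : 0 < p by exact: lt_le_trans p1.
have nf := measurable_normc mf; have ng := measurable_normc mg.
apply: le_trans (@minkowski_EFin _ _ _ plane_measure _ _ _ nf ng p1).
(* [|f| + |g|] is read as a complex valued function, so that the monotonicity
   of the norm applies. *)
pose h x := ((Normc.normc (f x) + Normc.normc (g x))%:C)%C.
rewrite (_ : Lnorm _ _ _ = Lpnorm p h); last first.
  congr Lnorm; apply/funext => x /=; congr EFin.
  by rewrite expr0n/= addr0 sqrtr_sqr ger0_norm// addr_ge0// normc_ge0.
apply: ae_le_Lpnorm => //; first exact: cmeasurableD.
  by split => //; apply: measurable_funD.
apply/nearW => x; rewrite /h/= expr0n/= addr0 sqrtr_sqr.
by rewrite ger0_norm ?addr_ge0 ?normc_ge0// le_normcD.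
Qed.

Definition cindic E : R * R -> R[i] := fun x => ((\1_E x : R)%:C)%C.

Lemma cmeasurable_cindic E : measurable E -> cmeasurable (cindic E).
Proof. by move=> mE; split => //; exact: measurable_indic. Qed.

Lemma normc_cindic E x : Normc.normc (cindic E x) = \1_E x.
Proof. by rewrite /= expr0n/= addr0 sqrtr_sqr ger0_norm. Qed.

Lemma Lpnorm_cindic p E : 0 < p -> measurable E ->
  Lpnorm p (cindic E) = (plane_measure E `^ p^-1)%E.
Proof.
move=> p0 mE; rewrite /Lpnorm unlock; congr poweR.
under eq_integral => x _.
  rewrite normc_cindic poweR_EFin/= (_ : _ `^ p = \1_E x); last first.
    rewrite indicE; case: (x \in E) => /=.
      by rewrite normr1 powR1.
    by rewrite normr0 powR0 ?gt_eqF.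
  over.
by rewrite integral_indic// setIT.
Qed.

Lemma inLp_cindic p E : 0 < p -> measurable E ->
  (plane_measure E < +oo)%E -> inLp p (cindic E).
Proof.
move=> p0 mE Ey; split; first exact: cmeasurable_cindic.
by rewrite Lpnorm_cindic// poweR_lty.
Qed.

Lemma le_opnorm p (S : operator) f : inLp p f -> (Lpnorm p f <= 1%:E)%E ->
  (Lpnorm p (S f) <= opnorm p S)%E.
Proof. by move=> pf f1; apply: ereal_sup_ubound; exists f. Qed.

Lemma plane_measure_rect (a b c e : R) : a <= b -> c <= e ->
  plane_measure (`[a, b]%classic `*` `[c, e[%classic)
  = ((b - a) * (e - c))%:E.
Proof.
move=> ab ce; transitivity
  (lebesgue_measure `[a, b]%classic * lebesgue_measure `[c, e[%classic)%E.
  exact: product_measure1E.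
rewrite !lebesgue_measure_itv/= !lte_fin.
have [ab'|ba] := ltP a b; have [ce'|ec] := ltP c e => //.
- by rewrite (_ : e = c) ?subrr ?mulr0 ?mule0//; apply/eqP; rewrite eq_le ec.
- by rewrite (_ : b = a) ?subrr ?mul0r ?mul0e//; apply/eqP; rewrite eq_le ba.
- by rewrite mul0e (_ : b = a) ?subrr ?mul0r//; apply/eqP; rewrite eq_le ba.
Qed.

End Lp_norm.

(** * Norm regularity of analytic semigroups *)

Section lipschitz.
Context {R : realType}.
Set Implicit Arguments.
Unset Strict Implicit.

Lemma sector_real (delta t : R) : 0 < delta -> 0 < t -> sector delta t%:C%C.
Proof.
move=> d0 t0; split.
  by rewrite eq_complex/= negb_and gt_eqF.
rewrite /Arg/= lexx expr0n/= addr0 sqrtr_sqr (gtr0_norm t0).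
by rewrite divff ?gt_eqF// acos1 normr0.
Qed.

(** The approach to [t] is along the real axis from the right, where the
    operators of the semigroup are known.  A radius of a ball of [R[i]] is a
    positive complex number, hence real. *)
Lemma opnorm_near_lt1 (p t : R) (F : R[i] -> @operator R) :
  opnorm p (F z) @[z --> ((t%:C)%C : (R[i] : numFieldType))^'] --> 0%E ->
  exists2 e : R, 0 < e & forall h, 0 < h < e ->
    (opnorm p (F (t + h)%:C%C) < 1)%E.
Proof.
move=> F0.
have /F0 : nbhs (0%E : \bar R) [set x | (x < 1)%E].
  apply: open_nbhs_nbhs; split; last by rewrite /= lte_fin.
  exact: open_ereal_lt_ereal.
rewrite /= /nbhs/= => -[/= e e0 ballF].
have eE : e = ((complex.Re e)%:C)%C by rewrite RRe_real// gtr0_real.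
exists (complex.Re e); first by rewrite -ltcR -eE.
move=> h /andP[h0 he]; apply: ballF => /=.
  rewrite /ball_/= rmorphD/= opprD addrA subrr sub0r normrN.
  rewrite eE ger0_norm ?ltcR// ler0c; exact: ltW.
by rewrite eq_complex/= negb_and -subr_eq0 addrC addKr gt_eqF.
Qed.

(** Near [t] the difference quotient is within operator distance 1 of the
    derivative [S'], which has norm at most [|M|]; hence the Lipschitz
    constant [1 + |M|]. *)
Lemma analytic_lipschitz (p t : R) (T : R -> @operator R) :
  1 <= p -> 0 < t -> (forall s, 0 <= s -> bounded_operator p (T s)) ->
  analytic_semigroup p T ->
  exists C e : R, [/\ 0 < C, 0 < e & forall h f, 0 < h < e ->
    inLp p f -> (Lpnorm p f <= 1%:E)%E ->
    (Lpnorm p (fun x => T (t + h) f x - T t f x)%R <= (C * h)%:E)%E].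
Proof.
move=> p1 t0 bT [delta [/andP[d0 _]]] [S [bS ST _ anS _]].
have p0 : 0 < p by exact: lt_le_trans p1.
have [S' [[S'p _ [M S'M]] S'lim]] := anS _ (sector_real d0 t0).
have [e e0 eS] := opnorm_near_lt1 S'lim.
exists (1 + `|M|), e; split => //.
move=> h f /andP[h0 he] pf f1.
have th0 : 0 < t + h by exact: addr_gt0.
have mS s : 0 < s -> cmeasurable (S s%:C%C f).
  by move=> s0; have [/(_ _ pf)[]] := bS _ (or_introl (sector_real d0 s0)).
have mT s : 0 < s -> cmeasurable (T s f).
  by move=> s0; have [/(_ _ pf)[]] := bT _ (ltW s0).
have mv : cmeasurable (S' f) by have [] := S'p _ pf.
pose z := ((t + h)%:C)%C; pose z0 := ((t%:C)%C).
(* The error of the difference quotient: [S z f - S z0 f = h * (u + S' f)]. *)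
pose u x := (z - z0)^-1 * (S z f x - S z0 f x) - S' f x.
have mu : cmeasurable u.
  by apply: cmeasurableB => //; apply/cmeasurableZ/cmeasurableB; exact: mS.
have zz0 : z - z0 = (h%:C)%C by rewrite -rmorphB addrC addKr.
have z0' : (h%:C)%C != 0 by rewrite eq_complex/= negb_and gt_eqF.
have u1 : (Lpnorm p u <= 1)%E.
  apply: (le_trans _ (ltW (eS h _))); last by rewrite h0.
  exact: le_opnorm.
have v1 : (Lpnorm p (S' f) <= `|M|%:E)%E.
  apply: (le_trans (S'M _ pf)); apply: (@le_trans _ _ (`|M|%:E * Lpnorm p f)%E).
    by apply: lee_wpmul2r; rewrite ?Lnorm_ge0 ?lee_fin ?ler_norm.
  by rewrite -[leRHS]mule1; apply: lee_wpmul2l; rewrite ?lee_fin.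
apply: (@le_trans _ _ (Lpnorm p (fun x => (h%:C)%C * (u x + S' f x))%R)).
  apply: ae_le_Lpnorm => //.
  - by apply: cmeasurableB; exact: mT.
  - by apply/cmeasurableZ/cmeasurableD.
  have eqh := ST _ _ (ltW th0) pf; have eq0 := ST _ _ (ltW t0) pf.
  apply: filterS2 eqh eq0 => x /(_ Logic.I) eh /(_ Logic.I) e0'.
  by rewrite -eh -e0' /u subrK zz0 mulrA divff// mul1r.
rewrite LpnormZ//; last exact: cmeasurableD.
rewrite /= expr0n/= addr0 sqrtr_sqr gtr0_norm// mulrC EFinM.
apply: lee_wpmul2l; first by rewrite lee_fin ltW.
by apply: (le_trans (LpnormD p1 mu mv)); rewrite EFinD leeD.
Qed.

End lipschitz.

(** * Transition probabilities *)

Section transition_indicator.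
Context {R : realType} {d : measure_display} {Omega : measurableType d}.
Variables (P : probability Omega R) (B : R -> {RV P >-> R}).
Set Implicit Arguments.
Unset Strict Implicit.

Lemma measurable_slice (t : R) (Q : set (R * R)) x : measurable Q ->
  measurable [set w | Q (x.1 + B t w, x.2 + t)].
Proof.
move=> mQ; set A := [set w | _]; rewrite -[A]setTI.
have : measurable_fun setT (fun w => (x.1 + B t w, x.2 + t)).
  by apply: measurable_fun_pair => //; exact: measurable_funD.
by move/(_ measurableT Q mQ).
Qed.

Lemma transition_cindic (t : R) (Q : set (R * R)) : measurable Q -> forall x,
  transition B t (cindic Q) x =
  ((fine (P [set w | Q (x.1 + B t w, x.2 + t)]))%:C)%C.
Proof.
move=> mQ x; set A := [set w | _].
have mA : measurable A by exact: measurable_slice.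
have AE w : \1_Q (x.1 + B t w, x.2 + t) = \1_A w :> R.
  by rewrite !indicE; congr (_%:R); congr nat_of_bool; apply/idP/idP; rewrite !inE.
rewrite /transition /cexpectation /cindic /=.
under eq_fun do rewrite AE.
by rewrite expectation_indic// expectation_cst.
Qed.

Lemma measurable_norm_le (X : {RV P >-> R}) (K : R) :
  measurable [set w | `|X w| <= K].
Proof.
have mX : measurable_fun setT (fun w => `|X w|) by exact: measurableT_comp.
have := mX measurableT `]-oo, K]%classic (measurable_itv _).
by rewrite setTI; congr measurable; apply/seteqP; split => w /=; rewrite in_itv.
Qed.

(** The sets [|X| <= n] exhaust a space of mass 1, so they cannot all be
    negligible. *)
Lemma tight (X : {RV P >-> R}) :
  exists K : R, 0 < K /\ (0 < P [set w | (`|X w| <= K)%R])%E.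
Proof.
pose F n := [set w | `|X w| <= n.+1%:R].
have mF n : measurable (F n) by exact: measurable_norm_le.
have FT : \bigcup_n F n = setT.
  apply/seteqP; split => // w _; exists (Num.truncn `|X w|) => //=.
  by apply/ltW; rewrite truncnS_gt.
have [[n Fn]|F0] := pselect (exists n, (0 < P (F n))%E).
  by exists n.+1%:R.
have : P.-negligible (\bigcup_n F n).
  apply: negligible_bigcup => n; exists (F n); split => //.
  by apply/eqP; rewrite -measure_le0 leNgt; apply/negP => Fn; apply: F0; exists n.
rewrite FT => /(measure_negligible measurableT) PT.
by have := probability_setT P; rewrite PT => /eqP; rewrite eqe eq_sym oner_eq0.
Qed.

End transition_indicator.

(** * Failure of analyticity *)

Theorem mainTheorem5 (R : realType) (d : measure_display)
    (Omega : measurableType d) (P : probability Omega R)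
    (B : R -> {RV P >-> R}) (p : R) (T : R -> @operator R) :
  standard_brownian_motion B ->
  1 <= p ->
  strongly_continuous_semigroup p T ->
  generated_by_spacetime_operator p T ->
  extends_transition p B T ->
  ~ analytic_semigroup p T.
Proof.
move=> _ p1 [bT _ _ _] _ TB anT.
have p0 : 0 < p by exact: lt_le_trans p1.
have [C [e [C0 e0 lip]]] := analytic_lipschitz p1 ltr01 bT anT.
have [K [K0 PK]] := tight (B 1).
pose A := [set w | `|B 1 w| <= K].
pose c := fine (P A).
have mA : measurable A by exact: measurable_norm_le.
have c0 : 0 < c by apply: fine_gt0; rewrite PK/= ltey_eq fin_num_measure.
(* [q] is the L^p norm of the indicator of a set of measure 1/2. *)
pose q := powR 2^-1 p^-1.
have q0 : 0 < q by rewrite powR_gt0.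
(* The three bounds on [h] give: the Lipschitz estimate, an area of [E] of at
   least 1/2, and the final contradiction [C * h < c * q]. *)
pose m := Num.min e (Num.min (4 * K)^-1 (c * q / C)).
have m0 : 0 < m by rewrite !lt_min e0 invr_gt0 !mulr_gt0 ?invr_gt0.
pose h := m / 2.
have h0 : 0 < h by rewrite divr_gt0.
have hm : h < m by rewrite ltr_pdivrMr// ltr_pMr// ltr1n.
have [he hK hC] : [/\ h < e, h < (4 * K)^-1 & h < c * q / C].
  by move: hm; rewrite !lt_min => /and3P[].
pose a := (2 * h)^-1.
have ah : a * h = 2^-1 by rewrite /a invfM -mulrA mulVf ?mulr1// gt_eqF.
have Kh : 4 * K * h < 1 by rewrite mulrC -ltr_pdivlMr ?div1r// mulr_gt0.
have aK : K * 2 <= a by rewrite -(ler_pM2r h0) ah; lra.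
pose Q := (`[- a, a]%classic `*` `[0, h[%classic : set (R * R)).
pose E := (`[- (a - K), a - K]%classic `*` `[-1, -1 + h[%classic : set (R * R)).
have a0 : 0 < a by rewrite invr_gt0 mulr_gt0.
have mQ : measurable Q by exact: measurableX.
have mE : measurable E by exact: measurableX.
have Q1 : plane_measure Q = 1%:E.
  by rewrite plane_measure_rect; [congr EFin; lra|lra|exact: ltW].
have Ehalf : ((2^-1)%:E <= plane_measure E)%E.
  by rewrite plane_measure_rect ?lee_fin; [lra|lra|lra].
have Qp : inLp p (cindic Q) by apply: inLp_cindic; rewrite ?Q1 ?ltry.
have Qnorm : (Lpnorm p (cindic Q) <= 1%:E)%E.
  by rewrite Lpnorm_cindic// Q1 poweR_EFin powR1.
have Qbd : exists M : R, forall x, Normc.normc (cindic Q x) <= M.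
  by exists 1 => x; rewrite normc_cindic indicE; case: (x \in Q).
have h1 : 0 <= 1 + h by rewrite addr_ge0// ltW.
(* On [E] the first function vanishes and the second one is at least [c]. *)
have low : ((c * q)%:E <=
    Lpnorm p (fun x => T (1 + h) (cindic Q) x - T 1 (cindic Q) x)%R)%E.
  have cE : Normc.normc (c%:C)%C = c.
    by rewrite /= expr0n/= addr0 sqrtr_sqr gtr0_norm.
  apply: (@le_trans _ _ (Lpnorm p (fun x => (c%:C)%C * cindic E x)%R)).
    rewrite LpnormZ//; last exact: cmeasurable_cindic.
    rewrite cE EFinM Lpnorm_cindic// lee_wpmul2l ?lee_fin ?(ltW c0)//.
    rewrite -poweR_EFin gt0_ler_poweR ?invr_ge0 ?(ltW p0)//.
    - by rewrite in_itv/= leey lee_fin invr_ge0 ler0n.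
    - by rewrite in_itv/= leey measure_ge0.
  apply: ae_le_Lpnorm => //.
  - exact/cmeasurableZ/cmeasurable_cindic.
  - apply: cmeasurableB.
      by have [/(_ _ Qp)[]] := bT _ h1.
    by have [/(_ _ Qp)[]] := bT _ ler01.
  apply: filterS2 (TB _ _ h1 Qp Qbd) (TB _ _ ler01 Qp Qbd).
  move=> x /(_ Logic.I) -> /(_ Logic.I) ->.
  rewrite Normc.normcM cE normc_cindic indicE.
  have [|_] := boolP (x \in E); last by rewrite mulr0 normc_ge0.
  rewrite inE => -[x1E x2E]; rewrite mulr1 !transition_cindic//.
  rewrite (_ : [set w | Q (_, x.2 + (1 + h))] = set0); last first.
    apply/seteqP; split => // w [_ /=].
    (* The second coordinate ends in [h <= x.2 < 2h], above [Q]. *)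
    by move: x2E; rewrite /= !in_itv/=; lra.
  rewrite measure0 /= !oppr0 addr0 sub0r sqrrN expr0n/= addr0 sqrtr_sqr.
  rewrite ger0_norm ?fine_ge0//.
  have mA' : measurable [set w | Q (x.1 + B 1 w, x.2 + 1)].
    exact: measurable_slice.
  apply: fine_le; rewrite ?fin_num_measure//.
  apply: le_measure; rewrite ?inE//.
  (* A move by at most [K] from the first side of [E] stays in that of [Q]. *)
  move=> w; rewrite /A/= ler_norml => BK; move: x1E x2E.
  by rewrite /Q/= !in_itv/=; lra.
have := le_trans low (lip h _ _ Qp Qnorm).
rewrite h0 he => /(_ isT); rewrite lee_fin leNgt => /negP; apply.
by rewrite mulrC -ltr_pdivlMr.
Qed.
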